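(* For all integers $p,q$ with $2\leq p\leq q$, there exists a graph $G$ with $\mathrm{fix}(G)=p$ and $\mathrm{fxd}(G)=q$.
   Context: Graphs are finite and simple. $\mathrm{Aut}(G)$ is the automorphism group of $G$; for $S\subseteq V(G)$, $\mathrm{stab}(S)=\{g\in \mathrm{Aut}(G): g(v)=v \text{ for all } v\in S\}$; $S$ is a fixing set if $\mathrm{stab}(S)$ is trivial. $\mathrm{fix}(G)$ is the minimum cardinality of a fixing set of $G$; $\mathrm{fxd}(G)$ is the minimum $k$ such that every $k$-element subset of $V(G)$ is a fixing set of $G$. *)

(* Defs.v *)
From mathcomp Require Import all_boot all_fingroup.

Set Implicit Arguments.
Unset Strict Implicit.
Unset Printing Implicit Defensive.

Local Open Scope group_scope.

Record sgraph := SGraph {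
  vertex :> finType;
  adj : rel vertex;
  adj_sym : symmetric adj;
  adj_irrefl : irreflexive adj }.

Section FixingSets.

Variable G : sgraph.
Implicit Types (S : {set G}) (g : {perm G}).

Definition graph_aut : {set {perm G}} :=
  [set g : {perm G} | [forall x, forall y, adj (g x) (g y) == adj x y]].

Lemma graph_autP g :
  reflect (forall x y, adj (g x) (g y) = adj x y) (g \in graph_aut).
Proof.
rewrite inE; apply: (iffP forallP) => [gA x y | gA x].
  by apply/eqP; exact: (forallP (gA x)).
by apply/forallP => y; apply/eqP.
Qed.

Lemma graph_aut_group_set : group_set graph_aut.
Proof.
apply/group_setP; split=> [|g h /graph_autP gA /graph_autP hA].
  by apply/graph_autP => x y; rewrite !perm1.
by apply/graph_autP => x y; rewrite !permM hA gA.
Qed.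

Canonical graph_aut_group : {group {perm G}} := Group graph_aut_group_set.

(* The pointwise, not setwise, stabiliser. *)
Definition stab S : {set {perm G}} := 'C_graph_aut(S | 'P).

Lemma stabP S g :
  reflect (g \in graph_aut /\ forall v, v \in S -> g v = v) (g \in stab S).
Proof.
apply: (iffP setIP) => [] [gA gS]; split=> //.
  by move=> v vS; apply: (astab_act gS vS).
by apply/astabP => v /gS.
Qed.

Definition fixing_set S : bool := stab S == 1.

Lemma fixing_setT : fixing_set setT.
Proof.
apply/eqP/setP => g; apply/idP/set1P => [/stabP[_ gT] | ->].
  by apply/permP => v; rewrite perm1 gT ?inE.
by apply/stabP; split=> [|v _]; rewrite ?group1 ?perm1.
Qed.

Definition has_fixing_set_of_card (k : nat) : bool :=
  [exists S : {set G}, (#|S| == k) && fixing_set S].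

Definition all_fixing_of_card (k : nat) : bool :=
  [forall S : {set G}, (#|S| == k) ==> fixing_set S].

Lemma ex_fixing_set : exists k, has_fixing_set_of_card k.
Proof.
by exists #|G|; apply/existsP; exists setT; rewrite cardsT eqxx fixing_setT.
Qed.

Lemma ex_all_fixing : exists k, all_fixing_of_card k.
Proof.
exists #|G|; apply/forallP => S; apply/implyP => cardS.
suff -> : S = setT by exact: fixing_setT.
by apply/eqP; rewrite eqEcard subsetT cardsT (eqP cardS) leqnn.
Qed.

Definition fix_num : nat := ex_minn ex_fixing_set.

(* For k > #|G| the property [all_fixing_of_card k] is vacuous, but k = #|G|
   satisfies it, so the minimum is at most #|G|. *)
Definition fxd_num : nat := ex_minn ex_all_fixing.

End FixingSets.

(* Main.v *)
(** Start from [p.+1] isolated vertices and add [q - p] further vertices,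
    alternately adjacent to all, or to none, of the vertices already present.
    The last vertex added is recognisable inside the graph, so by downward
    induction every automorphism fixes all the added vertices, while the
    initial [p.+1] vertices can be permuted freely. Hence a set is fixing iff it
    misses at most one initial vertex: the smallest such set has [p] elements,
    and the largest other set has [q.-1] elements (all but two initial ones). *)

Require Import Defs.
From mathcomp Require Import all_boot all_fingroup.

Set Implicit Arguments.
Unset Strict Implicit.
Unset Printing Implicit Defensive.

Lemma card_ord_lt m n : m <= n -> #|[set i : 'I_n | i < m]| = m.
Proof.
move=> le_mn; have winj : injective (widen_ord le_mn).
  by move=> i j /(congr1 val) /= ij; apply: val_inj.
rewrite -[RHS]card_ord -(card_imset predT winj); apply: eq_card => i.
rewrite inE; apply/idP/imsetP => [lt_im | [j _ ->] /=]; last exact: ltn_ord.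
by exists (Ordinal lt_im) => //; apply: val_inj.
Qed.

Section AlternatingThresholdGraph.

Variables (p q : nat).
Hypotheses (p_gt0 : 0 < p) (le_pq : p <= q).

(* The initial vertices are [0, ..., p]; truncated subtraction sends all of them
   to [0], hence two of them are not adjacent. *)
Definition alt_adj (x y : 'I_q.+1) : bool :=
  (x != y) && odd (maxn (x - p) (y - p)).

Lemma alt_adj_sym : symmetric alt_adj.
Proof. by move=> x y; rewrite /alt_adj eq_sym maxnC. Qed.

Lemma alt_adj_irrefl : irreflexive alt_adj.
Proof. by move=> x; rewrite /alt_adj eqxx. Qed.

Definition alt_graph : sgraph := SGraph alt_adj_sym alt_adj_irrefl.

Implicit Types (x y z : 'I_q.+1) (S : {set alt_graph}) (g : {perm alt_graph}).

Lemma alt_adj_lt x y : y < x -> alt_adj x y = odd (x - p).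
Proof.
move=> lt_yx; rewrite /alt_adj -val_eqE /= gtn_eqF //=.
by rewrite (maxn_idPl _) // leq_sub2r // ltnW.
Qed.

Lemma alt_aut_fix g x : g \in graph_aut alt_graph -> p < x -> g x = x.
Proof.
move=> /graph_autP /= gA; have [k] := ubnP (q - x).
elim: k x => // k IHk x lt_k lt_px.
have fix_gt y : x < y -> g y = y.
  move=> lt_xy; apply: IHk; last exact: ltn_trans lt_xy.
  rewrite -ltnS (leq_trans _ lt_k) // ltnS ltn_sub2l //.
  by rewrite -ltnS (leq_ltn_trans lt_xy).
have [gx_lt | gx_gt | /val_inj //] := ltngtP (g x) x; last first.
  by apply: (@perm_inj _ g); apply: fix_gt.
(* Since [g] fixes everything above [x], such a [z] is the image of some [u < x], so [g x] inherits
   the uniform adjacency of [x]. *)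
have adj_gx z : z < x -> z != g x -> alt_adj (g x) z = odd (x - p).
  move=> lt_zx; rewrite -[z](permKV g) (inj_eq perm_inj) gA.
  set u := (g^-1)%g z => neq_ux; apply: alt_adj_lt.
  rewrite ltn_neqAle val_eqE neq_ux leqNgt; apply/negP => lt_xu.
  have := fix_gt u lt_xu; rewrite permKV => zu.
  by move: lt_zx; rewrite zu ltnNge ltnW.
have lt_x1 : x.-1 < x by rewrite prednK // (leq_ltn_trans _ lt_px).
(* The predecessor of [x] has the opposite parity, so its adjacency to [g x < y] contradicts
   [adj_gx]. If [g x = y], vertex [0] serves as the test instead; it lies below [y] because
   [0 < p]. *)
pose y : 'I_q.+1 := Ordinal (ltn_trans lt_x1 (ltn_ord x)).
have odd_y : odd (y - p) = ~~ odd (x - p).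
  rewrite -[nat_of_ord x in RHS](ltn_predK lt_px) /= subSn ?oddS ?negbK //.
  by rewrite -ltnS (ltn_predK lt_px).
have le_gxy : g x <= y by rewrite -ltnS /= (ltn_predK lt_px).
have [gx_y | neq_gxy] := eqVneq (g x) y.
  have lt_0y : (ord0 : 'I_q.+1) < y.
    by rewrite /= -ltnS (ltn_predK lt_px) (leq_trans _ lt_px).
  have := adj_gx ord0; rewrite gx_y alt_adj_lt // odd_y.
  move=> /(_ (ltn_trans lt_0y lt_x1)); rewrite -val_eqE /= ltn_eqF // => /(_ isT).
  by case: odd.
have lt_gxy : g x < y by rewrite ltn_neqAle val_eqE neq_gxy.
have := adj_gx y lt_x1; rewrite eq_sym neq_gxy alt_adj_sym alt_adj_lt // odd_y.
by move=> /(_ isT); case: odd.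
Qed.

(** Adjacency sees a vertex only through equality and truncated [- p], and the latter is [0] at both
    points. *)
Lemma alt_aut_tperm x y :
  x <= p -> y <= p -> (tperm x y : {perm alt_graph}) \in graph_aut alt_graph.
Proof.
rewrite -!subn_eq0 => /eqP xp0 /eqP yp0; apply/graph_autP => u v /=.
have subp w : tperm x y w - p = w - p.
  by case: tpermP => [-> | -> |] //; rewrite xp0 yp0.
by rewrite /alt_adj (inj_eq perm_inj) !subp.
Qed.

Definition initial : {set alt_graph} := [set x : 'I_q.+1 | x < p.+1].

Lemma fixing_set_alt S : fixing_set S = (#|initial :\: S| <= 1).
Proof.
apply/idP/idP => [/eqP stabS | ].
  rewrite leqNgt; apply/negP => /card_gt1P[x [y []]].
  rewrite !inE => /andP[xS x_le] /andP[yS y_le] /eqP; apply.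
  have /set1P/permP/(_ x) : (tperm x y : {perm alt_graph}) \in [1]%g.
    rewrite -stabS; apply/stabP; split=> [|v vS]; first exact: alt_aut_tperm.
    by rewrite tpermD //; [apply: contraNneq xS | apply: contraNneq yS] => ->.
  by rewrite tpermL perm1.
move=> card_le1; apply/eqP/trivgP/subsetP => g /stabP[gA gS].
apply/set1P/permP => x; rewrite perm1; apply/eqP; apply: contraLR card_le1 => neq_gx.
have moved z : g z != z -> z \in initial :\: S.
  rewrite !inE => neq_gz; apply/andP; split.
    by apply: contraNN neq_gz => /gS ->.
  by rewrite ltnS leqNgt; apply: contraNN neq_gz => /(alt_aut_fix gA) ->.
(* If [g] moves [x], it also moves [g x], so [S] misses two initial vertices. *)
rewrite -ltnNge; apply/card_gt1P; exists (g x), x; split=> //; apply: moved => //.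
by rewrite (inj_eq perm_inj).
Qed.

Lemma card_initial : #|initial| = p.+1.
Proof. exact: card_ord_lt. Qed.

Lemma fix_num_alt : fix_num alt_graph = p.
Proof.
rewrite /fix_num; case: ex_minnP => k /existsP[S /andP[/eqP cardS]].
rewrite fixing_set_alt => fixS min_k; apply/eqP; rewrite eqn_leq; apply/andP; split.
  (* All initial vertices except [p]. *)
  apply: min_k; apply/existsP; exists [set x : 'I_q.+1 | x < p].
  have card_lt : #|[set x : 'I_q.+1 | x < p]| = p by rewrite card_ord_lt ?leqW.
  rewrite card_lt eqxx fixing_set_alt cardsD card_initial.
  rewrite (setIidPr _) ?card_lt ?subSnn //.
  by apply/subsetP => x; rewrite !inE => /leqW.
(* Split [initial] along [S]: at most [k] elements inside and at most one outside. *)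
rewrite -ltnS -card_initial -cardS -(cardsID S initial) -addn1 leq_add //.
by rewrite subset_leq_card ?subsetIr.
Qed.

Lemma fxd_num_alt : fxd_num alt_graph = q.
Proof.
rewrite /fxd_num; case: ex_minnP => k /forallP all_k min_k.
apply/eqP; rewrite eqn_leq; apply/andP; split.
  apply: min_k; apply/forallP => S; apply/implyP => /eqP cardS.
  rewrite fixing_set_alt (leq_trans (subset_leq_card (_ : _ \subset ~: S))) //.
    by rewrite setDE subsetIr.
  by rewrite cardsCs setCK cardS card_ord subSnn.
rewrite leqNgt; apply/negP => lt_kq.
(* For any [k < q], the last [k] vertices form a set that is not fixing: it misses [T], which has at
   least two elements, and so misses [0] and [1], both initial as [0 < p]. *)
pose T : {set alt_graph} := [set x : 'I_q.+1 | x < q.+1 - k].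
have cardCT : #|~: T| = k.
  by rewrite cardsCs setCK card_ord_lt ?leq_subr // card_ord subKn // ltnW // leqW.
have := implyP (all_k (~: T)); rewrite cardCT eqxx fixing_set_alt setDE setCK.
move=> /(_ isT); rewrite leqNgt => /negP; apply; apply/card_gt1P.
have q_gt0 : 0 < q := leq_trans p_gt0 le_pq.
exists ord0, (Ordinal (q_gt0 : 1 < q.+1)).
by rewrite !inE /= subn_gt0 ltn_subRL addn1 !ltnS p_gt0 lt_kq ltnW.
Qed.

End AlternatingThresholdGraph.

Theorem theorem6 (p q : nat) (hp : 2 <= p) (hpq : p <= q) :
  exists G : sgraph, fix_num G = p /\ fxd_num G = q.
Proof.
have p_gt0 := ltnW hp.
by exists (alt_graph p q); rewrite fix_num_alt // fxd_num_alt.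
Qed.
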